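(* Let $P$ and $Q$ be probability distributions on $\mathsf Z$, and let $a_P,a_Q\in\mathsf A$ be actions with $H_\ell(P)=\mathbb E_P[\ell(Z,a_P)]$ and $H_\ell(Q)=\mathbb E_Q[\ell(Z,a_Q)]$. If $\ell(z,a_Q)\in[\alpha_Q,\beta_Q]$ for all $z\in\mathsf Z$, then $$H_\ell(P)-H_\ell(Q)\le(\beta_Q-\alpha_Q)\,d_{\rm TV}(P,Q).$$ Consequently, if $\ell(z,a_P)\in[\alpha_P,\beta_P]$ for all $z\in\mathsf Z$, then $$H_\ell(Q)-H_\ell(P)\le(\beta_P-\alpha_P)\,d_{\rm TV}(P,Q).$$
   Context: $\mathsf Z$ is a (measurable) space of outcomes, $\mathsf A$ a space of actions, $\ell:\mathsf Z\times\mathsf A\to\mathbb R$ a loss function. The generalized entropy of a distribution $P$ on $\mathsf Z$ is $H_\ell(P)=\inf_{a\in\mathsf A}\mathbb E_P[\ell(Z,a)]$, where $Z\sim P$. It is assumed that the infimum is attained for the distributions considered. The total variation distance is $d_{\rm TV}(P,Q)=\frac12\int_{\mathsf Z}|P-Q|(\mathrm dz)$. *)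

(* Defs.v *)
From HB Require Import structures.
From mathcomp Require Import all_boot all_order all_algebra.
From mathcomp Require Import all_classical all_reals all_analysis.

Set Implicit Arguments.
Unset Strict Implicit.
Unset Printing Implicit Defensive.

Import Order.TTheory GRing.Theory Num.Theory.
Import numFieldNormedType.Exports.

Local Open Scope classical_set_scope.
Local Open Scope ring_scope.
Local Open Scope ereal_scope.

Section generalized_entropy.
Context {d : measure_display} {Z : measurableType d} {R : realType}.

(* Taken in \bar R: the infimum over an arbitrary action space may be
   infinite. *)
Definition gen_entropy {A : Type} (l : Z -> A -> R) (P : probability Z R) :
    \bar R :=
  ereal_inf (range (fun a : A => 'E_P[l^~ a])).

Definition diff_charge (P Q : probability Z R) : {charge set Z -> \bar R} :=
  cadd (charge_of_finite_measure P) (copp (charge_of_finite_measure Q)).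

Lemma diff_chargeP (P Q : probability Z R) :
  exists PN : set Z * set Z, hahn_decomposition (diff_charge P Q) PN.1 PN.2.
Proof.
by have [X [Y XY]] := Hahn_decomposition (diff_charge P Q); exists (X, Y).
Qed.

(* |P - Q| is the variation measure of the signed measure P - Q, i.e. the sum
   of its Jordan parts; these do not depend on the chosen Hahn decomposition
   (see Hahn_decomposition_uniq). *)
Definition dTV (P Q : probability Z R) : \bar R :=
  (2^-1)%:E * \int[charge_variation (projT2 (cid (diff_chargeP P Q)))]_z 1.

End generalized_entropy.

(* Main.v *)
Require Import Defs.
From HB Require Import structures.
From mathcomp Require Import all_boot all_order all_algebra.
From mathcomp Require Import all_classical all_reals all_analysis.
From mathcomp Require Import lra.

Set Implicit Arguments.
Unset Strict Implicit.
Unset Printing Implicit Defensive.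

Import Order.TTheory GRing.Theory Num.Theory.
Import numFieldNormedType.Exports.

Local Open Scope classical_set_scope.
Local Open Scope ring_scope.
Local Open Scope ereal_scope.

(** Since [aQ] is merely a candidate action for [P], the entropy of [P] is at most the
    [P]-expectation of [l^~ aQ], while the entropy of [Q] equals its [Q]-expectation. The claim thus
    reduces to comparing the expectations of one function with values in [a, b] under [P] and [Q]
    ([abse_expectationB_le]). There the Jordan parts of P - Q have equal mass, because [P] and [Q]
    both have mass 1, and this mass is [dTV P Q] ([dTV_jordan_pos]). The difference of expectations
    is a difference of two integrals against measures of that mass. Exchanging the roles of [P] and
    [Q] gives the second bound. *)

Section itv_bounded_integral.
Context {d : measure_display} {T : measurableType d} {R : realType}.
Variables (mu : {finite_measure set T -> \bar R}) (f : T -> R) (a b : R).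
Hypotheses (mf : measurable_fun [set: T] f) (fab : forall x, f x \in `[a, b]%R).

Lemma itv_bounded_integrable : mu.-integrable [set: T] (EFin \o f).
Proof.
apply: measurable_bounded_integrable => //.
  by rewrite ltey_eq fin_num_measure.
exists (`|a| + `|b|)%R; split; first exact: num_real.
move=> M ltM x _ /=; have /[!in_itv]/= /andP[ax xb] := fab x.
have := ler_norm b; have := ler_norm (- a); rewrite normrN => leNa leb.
have := normr_ge0 a; have := normr_ge0 b.
by rewrite ler_norml; lra.
Qed.

Lemma Rintegral_itv_bounded :
  (\int[mu]_x f x \in `[a * fine (mu setT), b * fine (mu setT)])%R.
Proof.
have cst_int c : mu.-integrable [set: T] (EFin \o cst c).
  exact: finite_measure_integrable_cst.
rewrite in_itv/= -!Rintegral_cst//; apply/andP; split.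
  apply: le_Rintegral => //; [exact: cst_int|exact: itv_bounded_integrable|].
  by move=> x _; have /[!in_itv]/= /andP[] := fab x.
apply: le_Rintegral => //; [exact: itv_bounded_integrable|exact: cst_int|].
by move=> x _; have /[!in_itv]/= /andP[] := fab x.
Qed.

End itv_bounded_integral.

Section expectation_dTV.
Context {d : measure_display} {Z : measurableType d} {R : realType}.
Variables P Q : probability Z R.

Let PN := projT2 (cid (diff_chargeP P Q)).
Let jp : {finite_measure set Z -> \bar R} := jordan_pos PN.
Let jn : {finite_measure set Z -> \bar R} := jordan_neg PN.

(** The Jordan decomposition of P - Q, rearranged so that both sides are measures and functions can
    be integrated against them. *)
Lemma add_jordan_eq (A : set Z) : measurable A ->
  P A + jn A = Q A + jp A.
Proof.
move=> mA; have e : P A - Q A = jp A - jn A.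
  by have := jordan_decomp PN mA; rewrite /cadd /= cscaleN1; exact.
have [finP finQ] := (fin_num_measure P A mA, fin_num_measure Q A mA).
have [finjp finjn] := (fin_num_measure jp A mA, fin_num_measure jn A mA).
by rewrite -(subeK (P A) finQ) e addeAC subeK// addeC.
Qed.

Lemma jordan_mass_eq : jn setT = jp setT.
Proof.
have := add_jordan_eq measurableT.
rewrite !probability_setT !(addeC 1) => /(congr1 (fun x => x - 1)).
by rewrite !addeK.
Qed.

(** The total variation is the sum of two equal masses, which the factor 1/2 compensates. *)
Lemma dTV_jordan_pos : dTV P Q = jp setT.
Proof.
have -> : dTV P Q = (2^-1)%:E * (jp setT + jn setT).
  by rewrite /dTV (@integral_cst _ _ _ _ _ measurableT 1) mul1e.
rewrite jordan_mass_eq.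
have : jp setT \is a fin_num by exact: fin_num_measure.
by move: (jp setT) => [r| |]//= _; rewrite -EFinD -EFinM; congr EFin; lra.
Qed.

(** Finiteness is what allows negation to distribute over a difference of expectations in
    [\bar R]. *)
Lemma expectation_fin_num_itv (mu : probability Z R) (f : Z -> R) (a b : R) :
  measurable_fun [set: Z] f -> (forall z, f z \in `[a, b]%R) ->
  'E_mu[f] \is a fin_num.
Proof.
move=> mf fab; rewrite unlock.
by apply: integrable_fin_num => //; exact: itv_bounded_integrable fab.
Qed.

(* With P + jn = Q + jp, where jp and jn have common mass dTV P Q, both
   integrals in \int f dP - \int f dQ = \int f djp - \int f djn lie between
   a * dTV P Q and b * dTV P Q. *)
Lemma abse_expectationB_le (f : Z -> R) (a b : R) :
  measurable_fun [set: Z] f -> (forall z, f z \in `[a, b]%R) ->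
  `|'E_P[f] - 'E_Q[f]| <= (b - a)%:E * dTV P Q.
Proof.
move=> mf fab; rewrite unlock.
have fi (mu : {finite_measure set Z -> \bar R}) :
  mu.-integrable [set: Z] (EFin \o f) by exact: itv_bounded_integrable fab.
have : \int[measure_add P jn]_x (f x)%:E = \int[measure_add Q jp]_x (f x)%:E.
  apply: eq_measure_integral => A mA _.
  apply: etrans (measure_addE P jn A) (etrans _ (esym (measure_addE Q jp A))).
  exact: add_jordan_eq.
rewrite (integral_measure_add _ (fi P) (fi jn))//.
rewrite (integral_measure_add _ (fi Q) (fi jp))//.
have Ef (mu : {finite_measure set Z -> \bar R}) :
    \int[mu]_x (f x)%:E = (\int[mu]_x f x)%R%:E.
  by rewrite /Rintegral fineK//; exact: integrable_fin_num (fi mu).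
rewrite !Ef dTV_jordan_pos.
have := Rintegral_itv_bounded jp mf fab; have := Rintegral_itv_bounded jn mf fab.
rewrite jordan_mass_eq.
have jpf : jp setT \is a fin_num by exact: fin_num_measure.
rewrite -[X in _ * X](fineK jpf) !in_itv/=.
move=> /andP[n1 n2] /andP[p1 p2].
rewrite -EFinM -!EFinD lee_fin => -[e].
(* With m the common mass, everything is now linear in the four integrals and the products a * m and
   b * m. *)
by rewrite mulrBl ler_norml; lra.
Qed.

End expectation_dTV.

Section gen_entropy.
Context {d : measure_display} {Z : measurableType d} {R : realType} {A : Type}.
Variable l : Z -> A -> R.

Lemma gen_entropy_le (P : probability Z R) (a : A) :
  gen_entropy l P <= 'E_P[l^~ a].
Proof. by apply: ereal_inf_lbound; exists a. Qed.

End gen_entropy.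

Theorem theorem1 (R : realType) (d : measure_display) (Z : measurableType d)
    (A : Type) (l : Z -> A -> R)
    (ml : forall a : A, measurable_fun [set: Z] (fun z => l z a))
    (P Q : probability Z R) (aP aQ : A)
    (HaP : gen_entropy l P = 'E_P[fun z => l z aP])
    (HaQ : gen_entropy l Q = 'E_Q[fun z => l z aQ]) :
  (forall alphaQ betaQ : R,
      (forall z : Z, l z aQ \in `[alphaQ, betaQ]%R) ->
      gen_entropy l P - gen_entropy l Q <= (betaQ - alphaQ)%:E * dTV P Q) /\
  (forall alphaP betaP : R,
      (forall z : Z, l z aP \in `[alphaP, betaP]%R) ->
      gen_entropy l Q - gen_entropy l P <= (betaP - alphaP)%:E * dTV P Q).
Proof.
split=> a b lab.
  rewrite HaQ; apply: le_trans (abse_expectationB_le P Q (ml aQ) lab).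
  by apply: le_trans (lee_abs _); apply: leeB => //; exact: gen_entropy_le.
rewrite HaP; apply: le_trans (abse_expectationB_le P Q (ml aP) lab).
have fin_E mu := expectation_fin_num_itv mu (ml aP) lab.
(* The absolute value also controls the reversed difference, so the same [dTV P Q] serves here. *)
rewrite -abseN fin_num_oppeB ?fin_E // addeC; apply: le_trans (lee_abs _).
by apply: leeD2l; exact: gen_entropy_le.
Qed.
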